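(* Let $(X(t):t\geqslant 0)$ be a martingale in $\mathcal{A}$, and let $f\colon[0,\infty)\to\mathcal{A}$ be a hermitian adapted process (i.e. $f(t)=f(t)^*\in\mathcal{A}_t$ for every $t\geqslant0$) such that $f$ is monotone. Then for each $t>0$ there exists a Riemann–Stieltjes type integral $\int_0^t f\,dX$, which is a densely defined operator on $\mathcal{H}$ affiliated with $\mathcal{A}$. That is, for every $x'\in\mathcal{A}'$ the limit $$\Big(\int_0^t f\,dX\Big)(x'\varOmega)=\lim_{\theta}S_\theta^r(x'\varOmega)$$ exists in the norm of $\mathcal{H}$ as the partition $\theta$ of $[0,t]$ is refined, and the operator with dense domain $\mathcal{A}'\varOmega$ so defined is affiliated with $\mathcal{A}$.
   Context: Setting. $\mathcal{A}$ is a von Neumann algebra acting in a Hilbert space $\mathcal{H}$, with commutant $\mathcal{A}'$. $\omega$ is a normal faithful state on $\mathcal{A}$ given by a unit vector $\varOmega\in\mathcal{H}$ that is cyclic and separating for $\mathcal{A}$: $\omega(x)=\langle x\varOmega,\varOmega\rangle$. (Hence $\varOmega$ is also cyclic and separating for $\mathcal{A}'$.) A filtration is given: an increasing family $\{\mathcal{A}_t:t\in[0,+\infty)\}$ of von Neumann subalgebras of $\mathcal{A}$ ($\mathcal{A}_s\subset\mathcal{A}_t$ for $s\leqslant t$), together with a family $\{\mathbb{E}_t\}$ of normal conditional expectations $\mathbb{E}_t$ from $\mathcal{A}$ onto $\mathcal{A}_t$ leaving $\omega$ invariant ($\omega\circ\mathbb{E}_t=\omega$). Processes. A process in $\mathcal{A}$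 is a function from $[0,+\infty)$ to $\mathcal{A}$. It is adapted if its value at each $t\geqslant0$ belongs to $\mathcal{A}_t$. A process $X$ in $\mathcal{A}$ is a martingale if $\mathbb{E}_sX(t)=X(s)$ for all $0\leqslant s\leqslant t$ (so a martingale is adapted). A process $f$ is monotone if it is increasing ($f(s)\leqslant f(t)$ for all $s\leqslant t$) or decreasing ($f(s)\geqslant f(t)$ for all $s\leqslant t$) in the operator order, where $a\leqslant b$ means that $b-a$ is a positive operator. Integral sums. For a partition $\theta=\{0=t_0<t_1<\dots<t_m=t\}$ of $[0,t]$ put $S_\theta^r=\sum_{k=1}^m f(t_{k-1})\,[X(t_k)-X(t_{k-1})]$. The partitions of $[0,t]$ form a directed set under inclusion (refinement), and $\lim_\theta$ denotes the limit of the net indexed by this directed set. Affiliation. An operator $T$ with domain $\mathcal{A}'\varOmega$ is affiliated with $\mathcal{A}$ if for every $y'\in\mathcal{A}'$ and every $\xi\in\mathcal{A}'\varOmega$ one has $y'\xi\in\mathcal{A}'\varOmega$ and $T y'\xi=y'T\xi$ (closedness of $T$ is not required). *)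

(* Defs.v *)
From HB Require Import structures.
From mathcomp Require Import all_boot all_order all_algebra.
From mathcomp Require Import all_classical all_reals all_analysis.
From mathcomp Require Import complex.

Set Implicit Arguments.
Unset Strict Implicit.
Unset Printing Implicit Defensive.

Import Order.TTheory GRing.Theory Num.Theory.
Import numFieldNormedType.Exports.

Local Open Scope classical_set_scope.
Local Open Scope ring_scope.

(* A complex Hilbert space is a complete normed space [H] over [complex R] with
   an inner product [dot] (linear on the left, conjugate-linear on the right)
   inducing the norm.  Operators are plain functions [H -> H], so that their
   equality is extensional and sums are pointwise. *)
Section Hilbert.
Context (R : realType) (H : completeNormedModType (complex R)).
Variable dot : {dot H for Num.conj}.

Implicit Types (a b x y : H -> H) (M N A D : set (H -> H)).

Definition hilbert_norm := forall xi : H, `|xi| ^+ 2 = dot xi xi.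

Definition bounded_operator a := linear a /\ continuous a.

Definition is_adjoint a b := forall xi eta, dot (a xi) eta = dot xi (b eta).

Definition hermitian_op a := is_adjoint a a.

(* [0 <= z] in [complex R] says that [z] is real and nonnegative. *)
Definition positive_op a := forall xi, 0 <= dot (a xi) xi.

Definition op_le a b := positive_op (b - a).

Definition commutant M : set (H -> H) :=
  [set b | bounded_operator b /\ forall a, M a -> a \o b = b \o a].

Definition von_neumann_algebra M :=
  [/\ M `<=` bounded_operator,
      forall a, M a -> exists2 b, M b & is_adjoint a b &
      commutant (commutant M) = M].

Definition vector_orbit M (xi : H) : set H := [set a xi | a in M].

Definition cyclic M (xi : H) := dense (vector_orbit M xi).

Definition separating M (xi : H) := forall a, M a -> a xi = 0 -> a = 0.

Definition vector_state (xi : H) a : complex R := dot (a xi) xi.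

Definition is_sup M D x :=
  [/\ M x, forall d, D d -> op_le d x &
      forall y, M y -> (forall d, D d -> op_le d y) -> op_le x y].

Definition upward_directed D :=
  D !=set0 /\
  forall x y, D x -> D y -> exists z, [/\ D z, op_le x z & op_le y z].

Definition normal_map M N (E : (H -> H) -> (H -> H)) :=
  forall D x, D `<=` M -> D `<=` hermitian_op -> upward_directed D ->
    is_sup M D x -> is_sup N (E @` D) (E x).

(* Only the values of [E] on [M] matter. *)
Record conditional_expectation M N (E : (H -> H) -> (H -> H)) : Prop := {
  condexp_range : forall x, M x -> N (E x);
  condexp_id : forall x, N x -> E x = x;
  condexp_linear : forall (c : complex R) x y, M x -> M y ->
    E (c *: x + y) = c *: E x + E y;
  condexp_positive : forall x, M x -> positive_op x -> positive_op (E x);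
  condexp_bimodule : forall a x b, N a -> M x -> N b ->
    E (a \o x \o b) = a \o E x \o b }.

(* Families indexed by [0, +oo[ are functions on [R], constrained (and used)
   only at nonnegative times. *)
Record filtration A (xi : H) (At : R -> set (H -> H))
    (E : R -> (H -> H) -> (H -> H)) : Prop := {
  filtration_vN : forall t, 0 <= t -> von_neumann_algebra (At t);
  filtration_sub : forall t, 0 <= t -> At t `<=` A;
  filtration_incr : forall s t, 0 <= s -> s <= t -> At s `<=` At t;
  filtration_condexp : forall t, 0 <= t -> conditional_expectation A (At t) (E t);
  filtration_normal : forall t, 0 <= t -> normal_map A (At t) (E t);
  filtration_state : forall t, 0 <= t ->
    forall x, A x -> vector_state xi (E t x) = vector_state xi x }.

Definition process A (X : R -> H -> H) := forall t, 0 <= t -> A (X t).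

Definition adapted (At : R -> set (H -> H)) (X : R -> H -> H) :=
  forall t, 0 <= t -> At t (X t).

Definition martingale A (E : R -> (H -> H) -> (H -> H)) (X : R -> H -> H) :=
  process A X /\ forall s t, 0 <= s -> s <= t -> E s (X t) = X s.

Definition hermitian_process (f : R -> H -> H) :=
  forall t, 0 <= t -> hermitian_op (f t).

Definition monotone_process (f : R -> H -> H) :=
  (forall s t, 0 <= s -> s <= t -> op_le (f s) (f t)) \/
  (forall s t, 0 <= s -> s <= t -> op_le (f t) (f s)).

(* The list [th = [:: t_1; ..; t_m]] stands for the partition
   [0 = t_0 < t_1 < .. < t_m = t]. *)
Definition RS_sum (f X : R -> H -> H) (th : seq R) : H -> H :=
  \sum_(k < size th)
    (f (nth 0 (0 :: th) k) \o (X (nth 0 (0 :: th) k.+1) - X (nth 0 (0 :: th) k))).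

(* Convergence along this filter is convergence of nets indexed by the
   partitions of [0, t] directed by inclusion. *)
Definition refinement_filter (t : R) : set_system (seq R) :=
  filter_from (itv_partition 0 t)
    (fun th => [set th' | itv_partition 0 t th' /\ {subset th <= th'}]).

(* Meaningful at those [xi] where the net of integral sums converges. *)
Definition RS_integral (f X : R -> H -> H) (t : R) (xi : H) : H :=
  lim (RS_sum f X th xi @[th --> refinement_filter t]).

(* [dom] is the domain of the (possibly unbounded) operator [T]; the values of
   [T] outside [dom] are irrelevant. *)
Definition densely_defined_operator (dom : set H) (T : H -> H) :=
  [/\ dense dom, dom 0 &
      forall (c : complex R) xi eta, dom xi -> dom eta ->
        dom (c *: xi + eta) /\ T (c *: xi + eta) = c *: T xi + T eta].

Definition affiliated A (dom : set H) (T : H -> H) :=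
  forall y', commutant A y' -> forall xi, dom xi ->
    dom (y' xi) /\ T (y' xi) = y' (T xi).

End Hilbert.

(* Main.v *)
From HB Require Import structures.
Require Import Defs.
From mathcomp Require Import all_boot all_order all_algebra.
From mathcomp Require Import all_classical all_reals all_analysis.
From mathcomp Require Import complex.
From mathcomp Require Import ring lra.
Import Order.TTheory GRing.Theory Num.Theory.
Import numFieldNormedType.Exports.
Local Open Scope classical_set_scope.
Local Open Scope ring_scope.

(* As y' commutes with the integral sums, S_theta (x' Omega) = x' (S_theta Omega),
   so only the net S_theta Omega matters.  Put xi t := X t Omega.  Invariance of
   the state under the conditional expectations makes the increments of xi
   orthogonal: <a (xi v - xi u), b Omega> = 0 for a, b in At u.  Let f be
   increasing and Phi theta := \sum_k <f t_{k-1} d_k xi, d_k xi>.  A positive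
   operator g with <g w, w> <= C |w|^2 satisfies |g w|^2 <= C <g w, w>; applied to
   g = f r - f s this gives, for theta' finer than theta,
     |S_theta' Omega - S_theta Omega|^2 <= C (Phi theta' - Phi theta).
   So Phi is increasing and bounded, and S_theta Omega is a Cauchy net.  If f is
   decreasing, use - f.  Density of A' Omega: the projection onto its closure
   commutes with A', hence lies in A'' = A, and its complement kills Omega. *)

Set Implicit Arguments.
Unset Strict Implicit.
Unset Printing Implicit Defensive.

(** * Real inner product geometry, and convergence and boundedness through squared norms *)

Section InnerProduct.
Context {R : realType} {H : completeNormedModType (complex R)}.
Variable dot : {dot H for Num.conj}.
Local Notation C := (complex R).
Implicit Types (u v w : H) (c : C) (r : R).

(* The real inner product: orthogonal projection and Riesz representation only
   need the real structure, and [dot_rdotP] recovers [dot]. *)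
Definition rdot u v : R := complex.Re (dot u v).
Definition sq u : R := rdot u u.

Lemma dotC u v : dot u v = (dot v u)^*%C.
Proof. by rewrite hermC expr0 mul1r. Qed.

Lemma rdotC u v : rdot u v = rdot v u.
Proof. by rewrite /rdot dotC; case: (dot v u). Qed.

Lemma ReD (a b : C) : complex.Re (a + b) = complex.Re a + complex.Re b.
Proof. by case: a; case: b. Qed.

Lemma ReN (a : C) : complex.Re (- a) = - complex.Re a.
Proof. by case: a. Qed.

Lemma ReZ r (a : C) : complex.Re (r%:C%C * a) = r * complex.Re a.
Proof. by case: a => x y /=; rewrite mul0r subr0. Qed.

Lemma rdotDl u v w : rdot (u + v) w = rdot u w + rdot v w.
Proof. by rewrite /rdot linearDl ReD. Qed.

Lemma rdotNl u w : rdot (- u) w = - rdot u w.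
Proof. by rewrite /rdot linearNl ReN. Qed.

Lemma rdotBl u v w : rdot (u - v) w = rdot u w - rdot v w.
Proof. by rewrite rdotDl rdotNl. Qed.

Lemma rdotZl r u w : rdot (r%:C%C *: u) w = r * rdot u w.
Proof. by rewrite /rdot linearZl_LR ReZ. Qed.

Lemma rdotDr u v w : rdot w (u + v) = rdot w u + rdot w v.
Proof. by rewrite !(rdotC w) rdotDl. Qed.

Lemma rdotNr u w : rdot w (- u) = - rdot w u.
Proof. by rewrite !(rdotC w) rdotNl. Qed.

Lemma rdotBr u v w : rdot w (u - v) = rdot w u - rdot w v.
Proof. by rewrite !(rdotC w) rdotBl. Qed.

Lemma rdotZr r u w : rdot w (r%:C%C *: u) = r * rdot w u.
Proof. by rewrite !(rdotC w) rdotZl. Qed.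

Lemma rdot0r w : rdot w 0 = 0.
Proof. by rewrite -(subrr w) rdotBr subrr. Qed.

Lemma rdot0l w : rdot 0 w = 0.
Proof. by rewrite rdotC rdot0r. Qed.

Lemma dot_sq u : dot u u = (sq u)%:C%C.
Proof.
rewrite /sq /rdot RRe_real//; apply: ger0_real; exact: dnorm_ge0.
Qed.

Lemma sq_ge0 u : 0 <= sq u.
Proof. by rewrite -ler0c -dot_sq; exact: dnorm_ge0. Qed.

Lemma sq0 : sq 0 = 0.
Proof. exact: rdot0l. Qed.

Lemma sq_eq0 u : sq u = 0 -> u = 0.
Proof. by move=> u0; apply/eqP; rewrite -(dnorm_eq0 dot) dot_sq u0. Qed.

Lemma sqD u v : sq (u + v) = sq u + sq v + 2 * rdot u v.
Proof. by rewrite /sq !(rdotDl, rdotDr) (rdotC v u); ring. Qed.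

Lemma sqN u : sq (- u) = sq u.
Proof. by rewrite /sq rdotNl rdotNr opprK. Qed.

Lemma sqB u v : sq (u - v) = sq u + sq v - 2 * rdot u v.
Proof. by rewrite sqD sqN rdotNr mulrN. Qed.

Lemma sqBC u v : sq (u - v) = sq (v - u).
Proof. by rewrite -sqN opprB. Qed.

Lemma sqZ r u : sq (r%:C%C *: u) = r ^+ 2 * sq u.
Proof. by rewrite /sq rdotZl rdotZr; ring. Qed.

Lemma sq_parallelogram u v : sq (u + v) + sq (u - v) = 2 * sq u + 2 * sq v.
Proof. by rewrite sqD sqB; ring. Qed.

Lemma ler_sqD u v : sq (u + v) <= 2 * sq u + 2 * sq v.
Proof. by rewrite -sq_parallelogram lerDl sq_ge0. Qed.

Lemma rdot_CS u v : rdot u v ^+ 2 <= sq u * sq v.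
Proof.
have [v0|v_gt0] := eqVneq (sq v) 0.
  by rewrite (sq_eq0 v0) rdot0r sq0 mulr0 expr0n.
have vp : 0 < sq v by rewrite lt_def v_gt0 sq_ge0.
(* This is [sq v] times the component of [u] orthogonal to [v], which avoids dividing by [sq v]. *)
have := sq_ge0 ((sq v)%:C%C *: u - (rdot u v)%:C%C *: v).
rewrite sqB !sqZ rdotZl rdotZr => h.
rewrite -(ler_pM2l vp); nra.
Qed.

Lemma rdot_conj c u v : rdot (c *: u) v = rdot u (c^*%C *: v).
Proof.
rewrite /rdot linearZl_LR linearZr_LR /=.
by case: c => a b; case: (dot u v) => x y /=; rewrite opprK.
Qed.

(** The scalar [c = 1] gives equality of real parts, and [c = i] gives equality of imaginary parts
    up to sign. *)
Lemma dot_rdotP u v u' v' :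
  (forall c, rdot (c *: u) v = rdot (c *: u') v') -> dot u v = dot u' v'.
Proof.
move=> h; have := h 1; have := h (Complex 0 1).
rewrite /rdot !linearZl_LR /=.
case: (dot u v) => x y; case: (dot u' v') => x' y' /=.
by rewrite !mul0r !mul1r !sub0r !subr0 => /oppr_inj -> ->.
Qed.

Hypothesis hn : hilbert_norm dot.

(** The norm takes values in [complex R]. This passage to the real number [sq u] lets all later
    estimates be real ones. *)
Lemma norm_ltE u r : 0 < r -> (`|u| < r%:C%C) = (sq u < r ^+ 2).
Proof.
move=> r0; rewrite -ltr_sqr ?nnegrE ?normr_ge0// ?ler0c ?ltW//.
by rewrite hn dot_sq -rmorphXn ltcR.
Qed.

Lemma pos_complexP c : 0 < c -> exists2 r, 0 < r & c = r%:C%C.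
Proof.
case: c => a b; rewrite ltcE /= => /andP[/eqP -> a0].
by exists a.
Qed.

Lemma sq_cauchy_cvg T (F : set_system T) (h : T -> H) : ProperFilter F ->
  (forall e, 0 < e -> exists c : H, \forall x \near F, sq (c - h x) < e) ->
  cvg (h x @[x --> F]).
Proof.
move=> PF hF; apply/cauchy_cvgP; apply: cauchy_exP => _ /pos_complexP [r r0 ->].
have [c hc] := hF (r ^+ 2) (exprn_gt0 _ r0).
exists c; rewrite /= near_simpl; near=> x.
rewrite -ball_normE /= norm_ltE//; near: x; exact: hc.
Unshelve. all: by end_near. Qed.

Lemma sq_cvg T (F : set_system T) (h : T -> H) l : Filter F ->
  h x @[x --> F] --> l ->
  forall e, 0 < e -> \forall x \near F, sq (l - h x) < e.
Proof.
move=> FF hl e e0.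
have e1 : 0 < Num.sqrt e by rewrite sqrtr_gt0.
have e2 : 0 < (Num.sqrt e)%:C%C by rewrite ltcR.
near=> x.
rewrite -(sqr_sqrtr (ltW e0)) -norm_ltE//.
by near: x; apply: cvgr_dist_lt.
Unshelve. all: by end_near. Qed.

Lemma cvg_sq T (F : set_system T) (h : T -> H) l : Filter F ->
  (forall e, 0 < e -> \forall x \near F, sq (l - h x) < e) ->
  h x @[x --> F] --> l.
Proof.
move=> FF hl; apply/cvgrPdist_lt => _ /pos_complexP [r r0 ->].
near=> x; rewrite norm_ltE//; near: x; apply: hl; exact: exprn_gt0.
Unshelve. all: by end_near. Qed.

Definition sq_bounded (a : H -> H) :=
  exists2 M : R, 0 < M & forall u, sq (a u) <= M * sq u.

(** Trades continuity for a real constant, the form in which the estimates on operators are carried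
    out. *)
Lemma bounded_operatorP (a : H -> H) :
  bounded_operator a <-> linear a /\ sq_bounded a.
Proof.
split=> -[la].
- move=> ca; split=> //.
  pose L : {linear H -> H} := HB.pack a (GRing.isLinear.Build _ _ _ _ a la).
  have /linear_boundedP/pinfty_ex_gt0[_ /pos_complexP [M M0 ->] hM] :=
    @continuous_linear_bounded _ _ _ 0 L (ca 0).
  exists (M ^+ 2); first exact: exprn_gt0.
  move=> u; rewrite -lecR rmorphM rmorphXn /= -!dot_sq -!hn -exprMn.
  have M1 : 0 <= M%:C%C :> C by rewrite ler0c ltW.
  by rewrite ler_sqr ?nnegrE ?mulr_ge0//; exact: hM.
- move=> [M M0 hM]; split=> // u.
  apply: cvg_sq => e e0.
  have eM : 0 < e / M by rewrite divr_gt0.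
  near=> v.
  have -> : a u - a v = a (u - v).
    by have h := la (-1) v u; rewrite !scaleN1r in h; rewrite addrC -h addrC.
  apply: le_lt_trans (hM _) _; rewrite -ltr_pdivlMl// mulrC.
  near: v; apply: (sq_cvg (h := id)) => //; exact: cvg_id.
Unshelve. all: by end_near. Qed.

End InnerProduct.

(** * Orthogonal projection and adjoints *)

Section Projection.
Context {R : realType} {H : completeNormedModType (complex R)}.
Variable dot : {dot H for Num.conj}.
Hypothesis hn : hilbert_norm dot.
Local Notation rdot := (rdot dot).
Local Notation sq := (sq dot).
Implicit Types (u v w : H) (r e : R) (V : set H).

(** Only real scalars are required, so that kernels of real-linear functionals qualify in
    [riesz_representation]. *)
Definition real_subspace V :=
  [/\ V 0, forall u v, V u -> V v -> V (u + v) &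
      forall r u, V u -> V (r%:C%C *: u)].

Definition adherence V : set H :=
  [set u | forall e, 0 < e -> exists2 v, V v & sq (u - v) < e].

Lemma near_sq u e : 0 < e -> \forall v \near u, sq (u - v) < e.
Proof. by move=> e0; apply: (sq_cvg hn (h := id)) => //; exact: cvg_id. Qed.

Lemma adherence_closed V : closed (adherence V).
Proof.
move=> u clu e e0; have e4 : 0 < e / 4 by rewrite divr_gt0.
have [v [Vv /= uv]] := clu _ (near_sq u e4).
have [w Vw vw] := Vv _ e4; exists w => //.
have -> : u - w = (u - v) + (v - w) by rewrite addrA subrK.
by apply: le_lt_trans (ler_sqD _ _ _) _; lra.
Qed.

Lemma sub_adherence V : V `<=` adherence V.
Proof. by move=> u Vu e e0; exists u => //; rewrite subrr sq0. Qed.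

Lemma adherence_image V W (a : H -> H) : bounded_operator a ->
  (forall u, V u -> W (a u)) -> forall u, adherence V u -> adherence W (a u).
Proof.
move=> /(bounded_operatorP hn)[la [M M0 hM]] aVW u Vu e e0.
have eM : 0 < e / M by rewrite divr_gt0.
have [v Vv uv] := Vu _ eM; exists (a v); first exact: aVW.
have -> : a u - a v = a (u - v).
  by have h := la (-1) v u; rewrite !scaleN1r in h; rewrite addrC -h addrC.
apply: le_lt_trans (hM _) _; by rewrite -ltr_pdivlMl// mulrC.
Qed.

Lemma adherence_subspace V : real_subspace V -> real_subspace (adherence V).
Proof.
move=> [V0 VD VZ]; split.
- exact: sub_adherence.
- move=> u v Vu Vv e e0; have e4 : 0 < e / 4 by rewrite divr_gt0.
  have [u' Vu' uu] := Vu _ e4; have [v' Vv' vv] := Vv _ e4.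
  exists (u' + v'); first exact: VD.
  rewrite opprD addrACA; apply: le_lt_trans (ler_sqD _ _ _) _; lra.
- move=> r u Vu e e0.
  have r1 : 0 < r ^+ 2 + 1 by rewrite ltr_wpDl ?sqr_ge0.
  have er : 0 < e / (r ^+ 2 + 1) by rewrite divr_gt0.
  have [v Vv uv] := Vu _ er; exists (r%:C%C *: v); first exact: VZ.
  rewrite -scalerBr sqZ; move: uv; rewrite ltr_pdivlMr// => uv.
  by have := sq_ge0 dot (u - v); lra.
Qed.

Lemma adherence_dense V : (forall u, adherence V u) -> dense V.
Proof.
move=> hV O [u Ou] oO.
have /nbhs_ballP[_ /pos_complexP [r r0 ->] hr] := open_nbhs_nbhs (conj oO Ou).
have [v Vv uv] := hV u (r ^+ 2) (exprn_gt0 _ r0).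
by exists v; split=> //; apply: hr; rewrite -ball_normE /= (norm_ltE hn).
Qed.

(** The vectors of [V] that nearly minimize the distance to [x] form a Cauchy filter, and its limit
    is the projection of [x]. *)
Lemma orthogonal_projection V : real_subspace V -> closed V ->
  forall x, exists2 v, V v & forall w, V w -> rdot (x - v) w = 0.
Proof.
move=> [V0 VD VZ] clV x.
pose S := [set sq (x - v) | v in V]; pose d := inf S.
have VB u v : V u -> V v -> V (u - v).
  move=> Vu Vv; apply: VD => //.
  by have := VZ (-1) _ Vv; rewrite rmorphN1 scaleN1r.
have hS : has_inf S.
  by split; [exists (sq (x - 0)), 0|exists 0 => _ [v _ <-]; exact: sq_ge0].
have dle v : V v -> d <= sq (x - v).
  by move=> Vv; apply: ge_inf; [exact: hS.2|exists v].
pose B e := [set v | V v /\ sq (x - v) < d + e].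
pose F : set_system H := filter_from [set e | 0 < e] B.
have FF : Filter F.
  apply: filter_from_filter; first by exists 1 => /=.
  move=> e1 e2 /= e10 e20; exists (Num.min e1 e2).
    by rewrite /= lt_min e10 e20.
  move=> v [Vv]; rewrite -ltrBlDl lt_min => /andP[h1 h2].
  by split; split=> //; rewrite -ltrBlDl.
have PF : ProperFilter F.
  apply: filter_from_proper => e /= e0.
  have [_ [v Vv <-] hv] := inf_adherent e0 hS.
  by exists v; split.
have cF : cvg ((fun v => v) v @[v --> F]).
  apply: (sq_cauchy_cvg hn) => e e0.
  have e4 : 0 < e / 4 by rewrite divr_gt0.
  have [_ [v Vv <-] hv] := inf_adherent e4 hS; exists v.
  exists (e / 4) => //= u [Vu hu].
  (* The midpoint of [u] and [v] lies in [V], so [sq ((x - v) + (x - u))] is at least [4 * d]; with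
     both distances below [d + e / 4] this leaves [sq (v - u) < e]. *)
  have h := sq_parallelogram dot (x - v) (x - u).
  have := dle ((1 / 2 : R)%:C%C *: (u + v)).
  have -> : x - (1 / 2 : R)%:C%C *: (u + v) =
            (1 / 2 : R)%:C%C *: ((x - v) + (x - u)).
    rewrite addrACA -opprD scalerBr (addrC v) (scalerDr _ x x) -scalerDl -rmorphD /=.
    have -> : 1 / 2 + 1 / 2 = 1 :> R by field.
    by rewrite rmorph1 scale1r.
  move=> /(_ (VZ _ _ (VD _ _ Vu Vv))); rewrite sqZ.
  have -> : v - u = - ((x - v) - (x - u)).
    by rewrite !opprB [RHS]addrC addrA subrK.
  by rewrite sqN; lra.
pose l := lim ((fun v => v) v @[v --> F]).
have Fl : (fun v => v) v @[v --> F] --> l by [].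
exists l.
  have FV : \forall v \near F, V v by exists 1 => //= v [].
  exact: (@closed_cvg _ _ F _ (fun v => v) V clV FV l Fl).
move=> w Vw.
(* Take [v] both nearly minimal and near [l]. The products of [x - v] and of [l - v] with [w] each
   have square at most [e * sq w], and the square of their difference is at most twice the sum of
   their squares. *)
have key e : 0 < e -> rdot (x - l) w ^+ 2 <= 4 * e * sq w.
  move=> e0.
  have [v [[Vv hv] lv]] : exists v, B e v /\ sq (l - v) < e.
    apply: (@filter_ex _ F); apply: filterI; last first.
      exact: (@sq_cvg _ _ _ hn _ F (fun v => v) l FF Fl e e0).
    by exists e.
  have h1 : rdot (x - v) w ^+ 2 <= e * sq w.
    have [w0|w0] := eqVneq (sq w) 0.
      by rewrite (sq_eq0 w0) rdot0r sq0 mulr0 expr0n.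
    have wp : 0 < sq w by rewrite lt_def w0 sq_ge0.
    (* The best correction of [v] along [w] lowers the squared distance by
       [rdot (x - v) w ^+ 2 / sq w]; the result is still at least [d], so the gain is at most
       [e]. *)
    have := dle _ (VD _ _ Vv (VZ (rdot (x - v) w / sq w) _ Vw)).
    rewrite opprD addrA sqB sqZ rdotZr => h.
    rewrite -ler_pdivrMr//.
    have h2 : (rdot (x - v) w / sq w) ^+ 2 * sq w = rdot (x - v) w ^+ 2 / sq w.
      by field.
    have h3 : rdot (x - v) w / sq w * rdot (x - v) w = rdot (x - v) w ^+ 2 / sq w.
      by field.
    by rewrite h2 h3 in h; lra.
  have h2 := rdot_CS dot (l - v) w.
  have h3 : sq (l - v) * sq w <= e * sq w.
    by rewrite ler_wpM2r ?sq_ge0 ?ltW.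
  have -> : rdot (x - l) w = rdot (x - v) w - rdot (l - v) w.
    by rewrite -rdotBl opprB addrA subrK.
  have := sqr_ge0 (rdot (x - v) w + rdot (l - v) w); nra.
have : rdot (x - l) w ^+ 2 <= 0.
  apply/ler_addgt0Pl => e e0; rewrite addr0.
  (* The summand [1] keeps the denominator positive when [w] is zero. *)
  have s1 : 0 < 4 * (sq w + 1) by have := sq_ge0 dot w; lra.
  apply: le_trans (key (e / (4 * (sq w + 1))) _) _; first by rewrite divr_gt0.
  have := sq_ge0 dot w; move: (sq w) s1 => s s1 s0.
  rewrite mulrAC mulrA ler_pdivrMr//; nra.
by rewrite le_eqVlt ltNge sqr_ge0 orbF sqrf_eq0 => /eqP.
Qed.

(** Unless [phi] vanishes, its kernel is a proper closed subspace, and the representing vector is a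
    multiple of the part of some [z] orthogonal to that kernel. *)
Lemma riesz_representation (phi : H -> R) (M : R) :
  (forall u v, phi (u + v) = phi u + phi v) ->
  (forall r u, phi (r%:C%C *: u) = r * phi u) ->
  (forall u, phi u ^+ 2 <= M * sq u) ->
  exists w, forall u, phi u = rdot u w.
Proof.
move=> phiD phiZ phiM.
have [phi0|/existsNP[z /eqP phiz]] := pselect (forall u, phi u = 0).
  by exists 0 => u; rewrite rdot0r.
pose V := [set u | phi u = 0].
have phiB u v : phi (u - v) = phi u - phi v.
  by rewrite phiD -[- v]scaleN1r -(rmorphN1 (real_complex R)) phiZ mulN1r.
have V0 : V 0 by rewrite /V /= -(subrr z) phiB subrr.
have subV : real_subspace V.
  by split=> // [u v /= hu hv|r u /= hu]; rewrite /V /= ?phiD ?phiZ ?hu ?hv ?addr0 ?mulr0.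
have clV : closed V.
  move=> u clu; apply/eqP; rewrite -sqrf_eq0 eq_le sqr_ge0 andbT.
  apply/ler_addgt0Pl => e e0; rewrite addr0.
  have M0 : 0 <= M.
    have := phiM z; have := sq_ge0 dot z; have : 0 < phi z ^+ 2.
      by rewrite lt_def sqr_ge0 sqrf_eq0 phiz.
    nra.
  have eM : 0 < e / (M + 1) by rewrite divr_gt0// ltr_wpDl.
  have [v [/= Vv uv]] := clu _ (near_sq u eM).
  have -> : phi u = phi (u - v) by rewrite phiB Vv subr0.
  apply: le_trans (phiM _) _; move: uv; rewrite ltr_pdivlMr ?ltr_wpDl//.
  have := sq_ge0 dot (u - v); nra.
have [v Vv hv] := orthogonal_projection subV clV z.
set w := z - v in hv.
have phiw : phi w != 0 by rewrite phiB Vv subr0.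
have wp : sq w != 0.
  by apply: contra phiw => /eqP/sq_eq0 ->; rewrite V0.
exists ((phi w / sq w)%:C%C *: w) => u.
(* This combination lies in the kernel of [phi], hence is orthogonal to [w]; solving the resulting
   equation gives [phi u]. *)
have := hv ((phi w)%:C%C *: u - (phi u)%:C%C *: w).
rewrite /V /= phiB !phiZ mulrC subrr => /(_ erefl).
rewrite rdotZr rdotBr !rdotZr -/(sq w) (rdotC _ w u) => h.
apply: (mulIf wp); rewrite mulrAC divfK//; lra.
Qed.

(** Riesz representation yields the adjoint for [rdot]; complex linearity of [a] and [dot_rdotP]
    lift the identity to [dot]. *)
Lemma bounded_adjoint (a : H -> H) : bounded_operator a ->
  exists b, [/\ bounded_operator b, is_adjoint dot a b & is_adjoint dot b a].
Proof.
move=> /(bounded_operatorP hn)[la [M M0 hM]].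
have aD u v : a (u + v) = a u + a v by have := la 1 u v; rewrite !scale1r.
have aZ c u : a (c *: u) = c *: a u.
  have a0 : a 0 = 0 by have := la (-1) 0 0; rewrite scaler0 addr0 scaleN1r addNr.
  by have := la c u 0; rewrite !addr0 a0 addr0.
have ex v : exists w, forall u, rdot (a u) v = rdot u w.
  apply: (@riesz_representation _ (M * sq v)) => [u u'|r u|u].
  - by rewrite aD rdotDl.
  - by rewrite aZ rdotZl.
  - apply: le_trans (rdot_CS _ _ _) _; rewrite mulrAC.
    by rewrite ler_wpM2r ?sq_ge0.
pose b v := projT1 (cid (ex v)).
have hb u v : rdot (a u) v = rdot u (b v) by rewrite /b; case: cid.
have adj : is_adjoint dot a b.
  move=> u v; apply: dot_rdotP => c.
  by rewrite -aZ hb.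
have adj' : is_adjoint dot b a.
  by move=> u v; rewrite dotC -adj dotC conjcK.
have uniq w w' : (forall u, rdot u w = rdot u w') -> w = w'.
  move=> h; apply/eqP; rewrite -subr_eq0; apply/eqP/(@sq_eq0 _ _ dot).
  by rewrite /sq rdotBr h subrr.
exists b; split=> //; apply/(bounded_operatorP hn); split.
  move=> c v w; apply: uniq => u.
  rewrite -hb !rdotDr -hb; congr (_ + _).
  by rewrite -[c]conjcK -!rdot_conj -hb aZ.
exists M => // v.
have [->|bv] := eqVneq (sq (b v)) 0; first by rewrite mulr_ge0 ?sq_ge0 ?ltW.
have bp : 0 < sq (b v) by rewrite lt_def bv sq_ge0.
(* The product of [a (b v)] with [v] is [sq (b v)], so Cauchy-Schwarz bounds [sq (b v) ^+ 2] by
   [M * sq (b v) * sq v], and one factor cancels. *)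
have := rdot_CS dot (a (b v)) v; rewrite hb -/(sq _) => h.
have h2 : sq (a (b v)) * sq v <= M * sq (b v) * sq v.
  by rewrite ler_wpM2r ?sq_ge0.
by rewrite -(ler_pM2l bp); nra.
Qed.

End Projection.

(** * Commutants and von Neumann algebras *)

Section VonNeumann.
Context {R : realType} {H : completeNormedModType (complex R)}.
Variable dot : {dot H for Num.conj}.
Hypothesis hn : hilbert_norm dot.
Local Notation rdot := (rdot dot).
Local Notation sq := (sq dot).
Implicit Types (u v w : H) (a b : H -> H) (M N A : set (H -> H)).

Lemma is_adjoint_sym a b : is_adjoint dot a b -> is_adjoint dot b a.
Proof. by move=> ab u v; rewrite dotC -ab dotC conjcK. Qed.

Lemma bounded_opP a c u v : bounded_operator a -> a (c *: u + v) = c *: a u + a v.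
Proof. by move=> [la _]; rewrite la. Qed.

Lemma bounded_op0 a : bounded_operator a -> a 0 = 0.
Proof.
by move=> ha; have := bounded_opP (-1) 0 0 ha; rewrite scaler0 addr0 scaleN1r addNr.
Qed.

Lemma bounded_opZ a c u : bounded_operator a -> a (c *: u) = c *: a u.
Proof.
by move=> ha; have := bounded_opP c u 0 ha; rewrite !addr0 (bounded_op0 ha) addr0.
Qed.

Lemma bounded_opD a u v : bounded_operator a -> a (u + v) = a u + a v.
Proof. by move=> ha; have := bounded_opP 1 u v ha; rewrite !scale1r. Qed.

Lemma bounded_opB a u v : bounded_operator a -> a (u - v) = a u - a v.
Proof. by move=> ha; rewrite bounded_opD// -scaleN1r bounded_opZ// scaleN1r. Qed.

Lemma bounded_op_comp a b :
  bounded_operator a -> bounded_operator b -> bounded_operator (a \o b).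
Proof.
move=> ha hb; split.
  by move=> c u v /=; rewrite (bounded_opP _ _ _ hb) (bounded_opP _ _ _ ha).
by move=> u; apply: continuous_comp; [exact: hb.2|exact: ha.2].
Qed.

Lemma bounded_op_lin c a b :
  bounded_operator a -> bounded_operator b -> bounded_operator (c *: a + b).
Proof.
move=> ha hb; split.
  move=> k u v.
  have E w : (c *: a + b) w = c *: a w + b w by [].
  rewrite !E (bounded_opP k u v ha) (bounded_opP k u v hb).
  by rewrite !scalerDr !scalerA (mulrC c k) addrACA.
move=> u; apply: cvgD; last exact: hb.2.
by apply: cvgZr; exact: ha.2.
Qed.

Lemma bounded_op_id : bounded_operator (@id H).
Proof. by split=> // u; exact: cvg_id. Qed.

Lemma commutant_bounded N : commutant N `<=` @bounded_operator R H.
Proof. by move=> b []. Qed.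

Lemma commutant_id N : commutant N id.
Proof. by split; first exact: bounded_op_id. Qed.

Lemma commutant_comp N a b : commutant N a -> commutant N b -> commutant N (a \o b).
Proof.
move=> [ha ca] [hb cb]; split; first exact: bounded_op_comp.
move=> n Nn; apply/funext => u /=.
have /(congr1 (fun f => f (b u))) /= -> := ca n Nn.
by have /(congr1 (fun f => f u)) /= -> := cb n Nn.
Qed.

Lemma commutantE N a n u : commutant N a -> N n -> n (a u) = a (n u).
Proof. by move=> [_ ca] /ca /(congr1 (fun f => f u)). Qed.

Lemma commutant_lin N c a b : N `<=` @bounded_operator R H ->
  commutant N a -> commutant N b -> commutant N (c *: a + b).
Proof.
move=> Nb ca cb; split; first by apply: bounded_op_lin; [exact: ca.1|exact: cb.1].
move=> n Nn; apply/funext => u; have E w : (c *: a + b) w = c *: a w + b w by [].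
rewrite /comp !E (bounded_opP c _ _ (Nb _ Nn)).
by rewrite (commutantE _ ca Nn) (commutantE _ cb Nn).
Qed.

Lemma commutantZ N c a : N `<=` @bounded_operator R H ->
  commutant N a -> commutant N (c *: a).
Proof.
move=> Nb ca; split.
  by have := bounded_op_lin (c - 1) ca.1 ca.1; rewrite scalerBl scale1r subrK.
move=> n Nn; apply/funext => u; have E w : (c *: a) w = c *: a w by [].
by rewrite /comp !E (bounded_opZ _ _ (Nb _ Nn)) (commutantE _ ca Nn).
Qed.

(** Moved to the other side of [dot], the products of [a] and [b'] become products of [a'] and [b],
    which commute. *)
Lemma commutant_adjoint N b b' :
  (forall a, N a -> exists2 a', N a' & is_adjoint dot a a') ->
  bounded_operator b' -> is_adjoint dot b b' -> commutant N b -> commutant N b'.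
Proof.
move=> Nadj hb' adj cb; split=> // a Na; have [a' Na' aa'] := Nadj _ Na.
have aa := is_adjoint_sym aa'; have adj' := is_adjoint_sym adj.
apply/funext => u /=; apply/eqP; rewrite -subr_eq0; apply/eqP/(@sq_eq0 _ _ dot).
rewrite /sq /rdot linearBl /= [X in X - _](_ : _ = dot (b' (a u)) (a (b' u) - b' (a u))).
  by rewrite subrr.
by rewrite aa' adj' -(commutantE _ cb Na') -aa' -adj'.
Qed.

Lemma vN_bounded M : von_neumann_algebra dot M -> M `<=` @bounded_operator R H.
Proof. by case. Qed.

Lemma vN_id M : von_neumann_algebra dot M -> M id.
Proof. by move=> [_ _ <-]; exact: commutant_id. Qed.

Lemma vN_comp M a b : von_neumann_algebra dot M -> M a -> M b -> M (a \o b).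
Proof. by move=> [_ _ <-]; exact: commutant_comp. Qed.

Lemma vN_lin M c a b : von_neumann_algebra dot M -> M a -> M b -> M (c *: a + b).
Proof. by move=> [_ _ <-]; apply: commutant_lin; exact: commutant_bounded. Qed.

Lemma vN_sub M a b : von_neumann_algebra dot M -> M a -> M b -> M (a - b).
Proof. by move=> hM ha hb; rewrite addrC -scaleN1r; exact: vN_lin. Qed.

Lemma vN_opp M a : von_neumann_algebra dot M -> M a -> M (- a).
Proof.
move=> hM ha; rewrite -[- a](addrK a) addNr; apply: vN_sub => //.
by rewrite -(subrr a); exact: vN_sub.
Qed.

Lemma separating_commutant_cyclic A (Omega : H) :
  von_neumann_algebra dot A -> separating A Omega ->
  cyclic (commutant A) Omega.
Proof.
move=> hA sep; have [Ab Aadj AE] := hA.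
pose A' := commutant A; pose V := adherence dot (vector_orbit A' Omega).
have orb b u : A' b -> vector_orbit A' Omega u -> vector_orbit A' Omega (b u).
  by move=> hb [a ha <-]; exists (b \o a) => //; exact: commutant_comp.
have Vact b u : A' b -> V u -> V (b u).
  move=> hb; apply: (adherence_image hn); first exact: hb.1.
  by move=> v; exact: orb.
(* Scalar multiples of the identity belong to the commutant, so [V] is even a complex subspace. *)
have VZ c u : V u -> V (c *: u).
  by apply: (Vact (c *: id)); apply: commutantZ => //; exact: commutant_id.
have subV : real_subspace V.
  apply: adherence_subspace; split.
  - exists (0 *: id); first by apply: commutantZ => //; exact: commutant_id.
    by rewrite !fctE scale0r.
  - move=> _ _ [a ha <-] [b hb <-]; exists (1 *: a + b); first exact: commutant_lin.
    by rewrite !fctE scale1r.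
  - move=> r _ [a ha <-]; exists (r%:C%C *: a); last by rewrite !fctE.
    exact: commutantZ.
have [V0 VD _] := subV.
have VB u v : V u -> V v -> V (u - v).
  by move=> Vu Vv; apply: VD => //; rewrite -scaleN1r; exact: VZ.
have ex u : exists q, V (u - q) /\ forall w, V w -> rdot q w = 0.
  have [v Vv hv] := orthogonal_projection hn subV (@adherence_closed _ _ _ hn _) u.
  by exists (u - v); split=> //; rewrite opprB addrC subrK.
(* [Q] is the projection onto the orthogonal complement of [V]. Linearity and commutation are read
   off its uniqueness property [Quniq]. *)
pose Q u := projT1 (cid (ex u)).
have QV u : V (u - Q u) by rewrite /Q; case: cid => q [].
have Qorth u w : V w -> rdot (Q u) w = 0 by rewrite /Q; case: cid => q [? h] /=; exact: h.
have Quniq u q : V (u - q) -> (forall w, V w -> rdot q w = 0) -> Q u = q.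
  move=> Vq hq; apply/eqP; rewrite -subr_eq0; apply/eqP/(@sq_eq0 _ _ dot).
  have Vd : V (Q u - q).
    by have := VB _ _ Vq (QV u); rewrite opprB addrC addrA subrK.
  by rewrite /sq rdotBl Qorth// hq// subrr.
have Qb : bounded_operator Q.
  apply/(bounded_operatorP hn); split.
    move=> c u v; apply: Quniq.
      rewrite opprD addrACA -scalerBr; apply: VD; [exact/VZ/QV|exact: QV].
    by move=> w Vw; rewrite rdotDl rdot_conj !Qorth ?addr0//; exact: VZ.
  exists 1 => // u; rewrite mul1r -[in leRHS](subrK (Q u) u) sqD rdotC Qorth//.
  by rewrite mulr0 addr0 lerDr sq_ge0.
(* By the bicommutant identity it suffices that [Q] commutes with every [b] in the commutant. Such a
   [b] preserves [V], and so does its adjoint, hence [b] preserves the complement as well. *)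
have QA : A Q.
  rewrite -AE; split=> // b hb; apply/funext => u /=; apply/esym/Quniq.
    by rewrite -bounded_opB; [exact: Vact|exact: hb.1].
  move=> w Vw; have [b' [hb' bb' _]] := bounded_adjoint hn hb.1.
  rewrite /rdot bb' -/(rdot _ _); apply/Qorth/Vact => //.
  exact: commutant_adjoint bb' hb.
(* The identity lies in the commutant, so [Omega] is in [V] and [Q] kills it; then [Omega]
   separates. *)
have Q0 : Q = 0.
  apply: sep => //; apply: Quniq; last by move=> w _; rewrite rdot0l.
  by rewrite subr0; apply: sub_adherence; exists id => //; exact: commutant_id.
by apply: (adherence_dense hn) => u; have := QV u; rewrite Q0 subr0.
Qed.

End VonNeumann.

(** * Quadratic forms of bounded and of positive operators *)

Section PositiveOperators.
Context {R : realType} {H : completeNormedModType (complex R)}.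
Variable dot : {dot H for Num.conj}.
Hypothesis hn : hilbert_norm dot.
Local Notation rdot := (rdot dot).
Local Notation sq := (sq dot).
Implicit Types (u v w : H) (a b g : H -> H).

Lemma rdot_bounded a : bounded_operator a ->
  exists2 K : R, 0 < K & forall u, `|rdot (a u) u| <= K * sq u.
Proof.
move=> /(bounded_operatorP hn)[_ [M M0 hM]]; exists (M + 1); first lra.
move=> u; have := hM u.
(* Together these bound twice the absolute value of the form by [sq (a u) + sq u]. *)
have := sq_ge0 dot (a u - u); have := sq_ge0 dot (a u + u).
rewrite sqD sqB; have := sq_ge0 dot u; have := sq_ge0 dot (a u).
move: (sq (a u)) (sq u) (rdot (a u) u) => x y z h1 h2 h3 h4 h5.
by rewrite ler_norml; apply/andP; split; lra.
Qed.

Lemma op_le_rdot a b u : op_le dot a b -> rdot (a u) u <= rdot (b u) u.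
Proof.
move=> /(_ u); rewrite lecE => /andP[_ /=].
have -> : (b - a) u = b u - a u by [].
by rewrite -/(rdot _ _) rdotBl subr_ge0.
Qed.

(* Expand the form of [g] at [u - C^-1 *: g u]. *)
Lemma sq_le_positive_form g (C : R) : bounded_operator g -> hermitian_op dot g ->
  0 < C -> (forall u, 0 <= rdot (g u) u <= C * sq u) ->
  forall u, sq (g u) <= C * rdot (g u) u.
Proof.
move=> hg herm C0 hC u.
have /andP[+ _] := hC (u - (C^-1)%:C%C *: g u).
have /andP[_ +] := hC (g u).
rewrite bounded_opB// bounded_opZ// rdotBl !rdotBr !rdotZl !rdotZr.
have -> : rdot (g (g u)) u = sq (g u) by rewrite /sq /rdot herm.
rewrite -/(sq (g u)).
move: (rdot (g (g u)) (g u)) (rdot (g u) u) (sq (g u)) => x y z h1 h2.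
have E : C * C^-1 = 1 by rewrite mulfV// gt_eqF.
have Cm : 0 < C^-1 by rewrite invr_gt0.
move: E Cm h1 h2; move: C^-1 => D E Cm h1 h2.
have h3 : D * (D * x) <= D * (D * (C * z)) by rewrite !ler_pM2l.
have h4 : D * (D * (C * z)) = D * z.
  by rewrite mulrCA [D * (C * z)]mulrA (mulrC D C) E mul1r mulrC.
have h5 : 0 <= C * (y - D * z) by apply: mulr_ge0; [exact: ltW|lra].
by move: h5; rewrite mulrBr mulrA E mul1r subr_ge0.
Qed.

End PositiveOperators.

(** * Integral sums *)

Section StepSums.
Context {R : realType} {H : completeNormedModType (complex R)}.
Variable dot : {dot H for Num.conj}.
Hypothesis hn : hilbert_norm dot.
Local Notation rdot := (rdot dot).
Local Notation sq := (sq dot).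
Implicit Types (u v w : H) (a b g : H -> H) (s t r : R) (p q th : seq R)
  (h f : R -> H -> H).
Variables (B : R -> set (H -> H)) (Omega : H) (xi : R -> H).

(** The integral sum applied to the cyclic vector, with its left end [s] explicit so that a
    partition can be cut at any of its points. Below, [form_sum] is the functional [Phi]. *)
Fixpoint step_sum h s p : H :=
  if p is r :: p' then h s (xi r - xi s) + step_sum h r p' else 0.

Fixpoint form_sum h s p : R :=
  if p is r :: p' then rdot (h s (xi r - xi s)) (xi r - xi s) + form_sum h r p'
  else 0.

Lemma step_sum_cat h s p q :
  step_sum h s (p ++ q) = step_sum h s p + step_sum h (last s p) q.
Proof. by elim: p s => [|r p IH] s /=; rewrite ?add0r// IH addrA. Qed.

Lemma form_sum_cat h s p q :
  form_sum h s (p ++ q) = form_sum h s p + form_sum h (last s p) q.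
Proof. by elim: p s => [|r p IH] s /=; rewrite ?add0r// IH addrA. Qed.

Lemma step_sumB h f s p :
  step_sum (h - f) s p = step_sum h s p - step_sum f s p.
Proof.
elim: p s => [|r p IH] s /=; first by rewrite subr0.
by rewrite IH !fctE opprD addrACA.
Qed.

Lemma form_sumB h f s p :
  form_sum (h - f) s p = form_sum h s p - form_sum f s p.
Proof.
elim: p s => [|r p IH] s /=; first by rewrite subr0.
by rewrite IH !fctE rdotBl opprD addrACA.
Qed.

Lemma step_sumN h s p : step_sum (- h) s p = - step_sum h s p.
Proof.
elim: p s => [|r p IH] s /=; first by rewrite oppr0.
by rewrite IH opprD.
Qed.

Lemma step_sum_const a s p : bounded_operator a ->
  step_sum (fun=> a) s p = a (xi (last s p) - xi s).
Proof.
move=> ha; elim: p s => [|r p IH] s /=; first by rewrite subrr bounded_op0.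
by rewrite IH -bounded_opD// [in LHS]addrC addrA subrK.
Qed.

Lemma path_le_last s p r : path <%R s p -> r \in s :: p -> r <= last s p.
Proof.
elim: p s r => [|x p IH] s r /=; first by rewrite inE => _ /eqP ->.
move=> /andP[sx xp]; rewrite inE => /orP[/eqP ->|]; last exact: IH.
by apply: le_trans (ltW sx) (IH _ x xp _); rewrite inE eqxx.
Qed.

Local Notation N s := (vector_orbit (B s) Omega).

Hypothesis BvN : forall t, 0 <= t -> von_neumann_algebra dot (B t).
Hypothesis Bincr : forall s t, 0 <= s -> s <= t -> B s `<=` B t.
Hypothesis xiN : forall t, 0 <= t -> N t (xi t).
(** The only property of martingales beyond adaptedness that the estimates use; [martingale_orth]
    supplies it. *)
Hypothesis xi_orth : forall s t a w, 0 <= s -> s <= t -> B s a -> N s w ->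
  rdot (a (xi t - xi s)) w = 0.

Lemma orbit_incr s t w : 0 <= s -> s <= t -> N s w -> N t w.
Proof. by move=> s0 st [a Ba <-]; exists a => //; exact: (Bincr s0 st). Qed.

Lemma orbit_act s a w : 0 <= s -> B s a -> N s w -> N s (a w).
Proof. by move=> s0 Ba [b Bb <-]; exists (a \o b) => //; exact: vN_comp (BvN s0) _ _. Qed.

Lemma orbitD s v w : 0 <= s -> N s v -> N s w -> N s (v + w).
Proof.
move=> s0 [a Ba <-] [b Bb <-]; exists (1 *: a + b).
  exact: vN_lin (BvN s0) _ _.
by rewrite !fctE scale1r.
Qed.

Lemma orbitN s w : 0 <= s -> N s w -> N s (- w).
Proof. by move=> s0 [a Ba <-]; exists (- a) => //; exact: vN_opp (BvN s0) _. Qed.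

Lemma orbit_increment s t : 0 <= s -> s <= t -> N t (xi t - xi s).
Proof.
move=> s0 st; have t0 := le_trans s0 st.
by apply: orbitD => //; [exact: xiN|apply: orbitN => //; exact: orbit_incr (xiN s0)].
Qed.

(** Each term starts at some [r >= s] with coefficient in [B r], and [w] also lies in the larger
    orbit at [r], so [xi_orth] kills every term. *)
Lemma step_sum_orth h s p w : 0 <= s -> path <%R s p ->
  (forall r, s <= r -> r <= last s p -> B r (h r)) -> N s w ->
  rdot (step_sum h s p) w = 0.
Proof.
elim: p s => [|r p IH] s s0 /=; first by rewrite rdot0l.
move=> /andP[sr rp] hB Nw; have r0 := le_trans s0 (ltW sr).
have rl : r <= last r p by apply: path_le_last => //; rewrite inE eqxx.
have Bs : B s (h s) by apply: hB => //; exact: le_trans (ltW sr) rl.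
rewrite rdotDl (xi_orth s0 (ltW sr) Bs Nw) add0r.
rewrite IH//; last exact: orbit_incr (ltW sr) Nw.
by move=> x rx; apply: hB; exact: le_trans (ltW sr) rx.
Qed.

(** Allows a sum up to some time to serve as [w] in [step_sum_orth] for a sum starting there. *)
Lemma step_sum_orbit h s p : 0 <= s -> path <%R s p ->
  (forall r, s <= r -> r <= last s p -> B r (h r)) ->
  N (last s p) (step_sum h s p).
Proof.
elim: p s => [|r p IH] s s0 /=.
  move=> _ _; exists 0 => //; rewrite -(subrr id).
  by apply: (vN_sub (BvN s0)); exact: (vN_id (BvN s0)).
move=> /andP[sr rp] hB; have r0 := le_trans s0 (ltW sr).
have rl : r <= last r p by apply: path_le_last => //; rewrite inE eqxx.
have sl := le_trans (ltW sr) rl.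
apply: orbitD; first exact: le_trans rl.
  apply: (orbit_incr r0 rl); apply: orbit_act => //; last exact: orbit_increment (ltW sr).
  by apply: (Bincr s0 (ltW sr)); exact: hB.
by apply: IH => // x rx; apply: hB; exact: le_trans (ltW sr) rx.
Qed.

(** By Pythagoras: the first term lies in the orbit at [r], so it is orthogonal to the remaining
    sum, and the hypothesis bounds each term separately. *)
Lemma sq_step_sum_le h (C : R) s p : 0 <= s -> path <%R s p ->
  (forall r, s <= r -> r <= last s p -> B r (h r)) ->
  (forall r w, s <= r -> r <= last s p -> sq (h r w) <= C * rdot (h r w) w) ->
  sq (step_sum h s p) <= C * form_sum h s p.
Proof.
elim: p s => [|r p IH] s s0 /=; first by rewrite sq0 mulr0.
move=> /andP[sr rp] hB hC; have r0 := le_trans s0 (ltW sr).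
have rl : r <= last r p by apply: path_le_last => //; rewrite inE eqxx.
have sl := le_trans (ltW sr) rl.
have hB' x : r <= x -> x <= last r p -> B x (h x).
  by move=> rx; apply: hB; exact: le_trans (ltW sr) rx.
rewrite sqD (rdotC _ _ (step_sum _ _ _)) step_sum_orth//; last first.
  apply: orbit_act => //; last exact: orbit_increment (ltW sr).
  by apply: (Bincr s0 (ltW sr)); exact: hB.
rewrite mulr0 addr0 mulrDr lerD ?hC// IH// => x w rx.
by apply: hC; exact: le_trans (ltW sr) rx.
Qed.

(** For a constant coefficient the cross terms between disjoint increments vanish, so the form is
    additive over the partition. *)
Lemma form_sum_const a s p : 0 <= s -> path <%R s p -> B s a ->
  form_sum (fun=> a) s p = rdot (a (xi (last s p) - xi s)) (xi (last s p) - xi s).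
Proof.
elim: p s => [|r p IH] s s0 /=; first by rewrite subrr rdot0r.
move=> /andP[sr rp] Ba; have r0 := le_trans s0 (ltW sr).
have rl : r <= last r p by apply: path_le_last => //; rewrite inE eqxx.
have ha : bounded_operator a by apply: (vN_bounded (BvN s0)).
have Ba' : B r a by exact: (Bincr s0 (ltW sr)).
have Nd := orbit_increment s0 (ltW sr).
have -> : xi (last r p) - xi s = (xi (last r p) - xi r) + (xi r - xi s).
  by rewrite addrA subrK.
have o1 := xi_orth r0 rl Ba' Nd.
have o2 : rdot (a (xi r - xi s)) (xi (last r p) - xi r) = 0.
  have := xi_orth r0 rl (vN_id (BvN r0)) (orbit_act r0 Ba' Nd).
  by rewrite rdotC.
rewrite IH//; move: o1 o2; move: (xi r - xi s) (xi (last r p) - xi r) => d e o1 o2.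
by rewrite bounded_opD// rdotDl !rdotDr o1 o2 addr0 add0r addrC.
Qed.

(** Induction on the coarse partition [p]. On one of its intervals, starting at [s], the two sums
    differ by the step sum of [f - f s], which [sq_step_sum_le] controls. *)
Lemma refinement_le f (C : R) t : (forall r, 0 <= r -> B r (f r)) ->
  (forall s r w, 0 <= s -> s <= r -> r <= t ->
     sq (f r w - f s w) <= C * rdot (f r w - f s w) w) ->
  forall s p q, 0 <= s -> path <%R s p -> path <%R s q ->
  last s p = last s q -> last s p <= t -> {subset p <= q} ->
  sq (step_sum f s q - step_sum f s p) <= C * (form_sum f s q - form_sum f s p).
Proof.
move=> fB fC s p; elim: p s => [|r p IH] s q s0 /=.
  move=> _ sq sl _ _.
  have -> : q = [::] by apply: (@itv_partitionxx _ _ s); split=> //; rewrite -sl.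
  by rewrite !subrr sq0 mulr0.
move=> /andP[sr rp] + lpq lt pq.
(* The errors before and after the first point [r] of [r :: p] are orthogonal. *)
have : r \in q by apply: pq; rewrite inE eqxx.
move=> rq sq'; case/path.splitP: rq pq lpq sq' => q1 q2 pq lpq.
rewrite cat_path last_rcons => /andP[sq1 rq2].
have r0 := le_trans s0 (ltW sr).
have lr : last s (rcons q1 r) = r by rewrite last_rcons.
have rl : r <= last r p by apply: path_le_last => //; rewrite inE eqxx.
rewrite last_cat last_rcons in lpq.
have IHq : sq (step_sum f r q2 - step_sum f r p) <=
    C * (form_sum f r q2 - form_sum f r p).
  apply: IH => // x xp.
  have rx : r < x by have /allP := order_path_min lt_trans rp; exact.
  have := pq x; rewrite inE xp orbT mem_cat => /(_ isT) /orP[xq1|//].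
  have : x <= r.
    by rewrite -lr; apply: path_le_last => //; rewrite inE xq1 orbT.
  by rewrite leNgt rx.
rewrite step_sum_cat form_sum_cat last_rcons.
have Bfs : B s (f s) by exact: fB.
have bfs : bounded_operator (f s) by exact: (vN_bounded (BvN s0)).
(* The single coarse term over [[s, r]] is also the step sum of the constant [f s] over the fine
   points, by telescoping. *)
have S1 : step_sum (f - fun=> f s) s (rcons q1 r) =
    step_sum f s (rcons q1 r) - f s (xi r - xi s).
  by rewrite step_sumB step_sum_const// lr.
have F1 : form_sum (f - fun=> f s) s (rcons q1 r) =
    form_sum f s (rcons q1 r) - rdot (f s (xi r - xi s)) (xi r - xi s).
  by rewrite form_sumB form_sum_const// lr.
have hB x : s <= x -> x <= last s (rcons q1 r) -> B x ((f - fun=> f s) x).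
  move=> sx _; have x0 := le_trans s0 sx.
  by apply: (vN_sub (BvN x0)); [exact: fB|exact: (Bincr s0 sx)].
have h1 : sq (step_sum (f - fun=> f s) s (rcons q1 r)) <=
          C * form_sum (f - fun=> f s) s (rcons q1 r).
  apply: sq_step_sum_le => // x w sx; rewrite lr => xr.
  by apply: fC => //; exact: le_trans xr (le_trans rl lt).
have NT : N r (step_sum (f - fun=> f s) s (rcons q1 r)).
  by rewrite -[X in N X]lr; apply: step_sum_orbit.
have o z : path <%R r z ->
    rdot (step_sum f r z) (step_sum (f - fun=> f s) s (rcons q1 r)) = 0.
  move=> rz; apply: step_sum_orth => // x rx _; apply: fB; exact: le_trans rx.
rewrite !opprD !(addrACA _ _ (- _)) -S1 -F1 sqD rdotC rdotBl !o// subrr.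
by rewrite mulr0 addr0 mulrDr lerD.
Qed.

(** By [form_sum_const] for the identity, the squared increments add up to that of the whole
    interval. This makes the bound independent of the partition. *)
Lemma form_sum_le f (C : R) t s p : 0 <= s -> path <%R s p -> last s p <= t ->
  (forall r w, 0 <= r -> r <= t -> rdot (f r w) w <= C * sq w) ->
  form_sum f s p <= C * sq (xi (last s p) - xi s).
Proof.
move=> s0 sp pt fC.
have -> : sq (xi (last s p) - xi s) = form_sum (fun=> id) s p.
  by rewrite form_sum_const//; exact: (vN_id (BvN s0)).
elim: p s s0 sp pt => [|r p IH] s s0 /=; first by rewrite mulr0.
move=> /andP[sr rp] pt; have r0 := le_trans s0 (ltW sr).
have rl : r <= last r p by apply: path_le_last => //; rewrite inE eqxx.
rewrite mulrDr; apply: lerD; last exact: IH.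
by apply: fC => //; exact: le_trans (ltW sr) (le_trans rl pt).
Qed.

(** Common refinements, which make the refinement sets a filter base. Removing duplicates before
    sorting makes the path strict. *)
Lemma path_merge s p q : path <%R s p -> path <%R s q ->
  last s p = last s q ->
  exists z, [/\ path <%R s z, last s z = last s p, {subset p <= z} & {subset q <= z}].
Proof.
move=> sp sq pq; pose z := sort <=%R (undup (p ++ q)).
have memz x : (x \in z) = (x \in p) || (x \in q).
  by rewrite mem_sort mem_undup mem_cat.
have sz : path <%R s z.
  rewrite path_sortedE; last exact: lt_trans.
  apply/andP; split.
    apply/allP => x; rewrite memz => /orP[] xz.
      by have /allP := order_path_min lt_trans sp; exact.
    by have /allP := order_path_min lt_trans sq; exact.
  by rewrite lt_sorted_uniq_le sort_uniq undup_uniq sort_le_sorted.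
exists z; split=> // [|x xp|x xq]; [|by rewrite memz xp|by rewrite memz xq orbT].
apply/eqP; rewrite eq_le; apply/andP; split; last first.
  have := mem_last s p; rewrite inE => /orP[/eqP ->|lp].
    by apply: path_le_last => //; rewrite inE eqxx.
  by apply: path_le_last => //; rewrite inE memz lp orbT.
have := mem_last s z; rewrite !inE memz => /or3P[/eqP ->|lp|lq].
- by apply: path_le_last => //; rewrite inE eqxx.
- by apply: path_le_last => //; rewrite inE lp orbT.
- by rewrite pq; apply: path_le_last => //; rewrite inE lq orbT.
Qed.

Lemma refinement_filter_proper t : 0 < t -> ProperFilter (refinement_filter t).
Proof.
move=> t0; apply: filter_from_proper; last first.
  by move=> p pt; exists p; split.
apply: filter_from_filter.
  by exists [:: t]; apply: itv_partition1.
move=> p q [p0 /eqP pt] [q0 /eqP qt].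
have [|z [z0 zt pz qz]] := path_merge p0 q0; first by rewrite pt qt.
exists z; first by split=> //; rewrite zt pt.
move=> z' [Pz' zz']; split; split=> // x; [move=> /pz|move=> /qz]; exact: zz'.
Qed.

Lemma step_sum_cvg f t : 0 < t ->
  (forall r, 0 <= r -> B r (f r)) ->
  (forall r, 0 <= r -> hermitian_op dot (f r)) ->
  (forall s r, 0 <= s -> s <= r -> op_le dot (f s) (f r)) ->
  cvg (step_sum f 0 p @[p --> refinement_filter t]).
Proof.
move=> t0 fB fh fi; have tt := ltW t0.
have fb r : 0 <= r -> bounded_operator (f r).
  by move=> r0; exact: (vN_bounded (BvN r0) (fB r r0)).
have [K K0 hK] := rdot_bounded hn (fb t tt).
have [K' K'0 hK'] := rdot_bounded hn (fb 0 (lexx 0)).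
(* Monotonicity gives [f r - f s <= f t - f 0], whose form is at most [(K + K') * sq u]. *)
pose C := K + K'; have C0 : 0 < C by rewrite addr_gt0.
have fC s r w : 0 <= s -> s <= r -> r <= t ->
    sq (f r w - f s w) <= C * rdot (f r w - f s w) w.
  move=> s0 sr rt; have r0 := le_trans s0 sr.
  apply: (@sq_le_positive_form _ _ _ (f r - f s) C).
  - apply: (vN_bounded (BvN r0)); apply: (vN_sub (BvN r0)); first exact: fB.
    exact: (Bincr s0 sr (fB _ s0)).
  - move=> u v; rewrite !fctE linearBl linearBr; congr (_ - _); exact: fh.
  - by [].
  - move=> u; rewrite !fctE rdotBl.
    have h1 := op_le_rdot u (fi _ _ s0 sr).
    have h2 := op_le_rdot u (fi _ _ r0 rt).
    have h3 := op_le_rdot u (fi _ _ (lexx 0) s0).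
    have := hK u; have := hK' u; rewrite !ler_norml => /andP[h4 _] /andP[_ h5].
    by rewrite subr_ge0 h1 /= /C mulrDl; lra.
pose part := itv_partition 0 t.
pose S := [set form_sum f 0 p | p in part].
have hS : has_sup S.
  split.
    by exists (form_sum f 0 [:: t]), [:: t] => //; exact: itv_partition1.
  exists (K * sq (xi t - xi 0)) => _ [p [p0 /eqP pt] <-].
  rewrite -[X in xi X - _]pt; apply: (@form_sum_le _ _ t) => //; first by rewrite pt.
  move=> r w r0 rt; apply: le_trans (op_le_rdot w (fi _ _ r0 rt)) _.
  by have := hK w; rewrite ler_norml => /andP[].
have PF := refinement_filter_proper t0.
apply: (sq_cauchy_cvg hn) => e e0.
have eC : 0 < e / C by rewrite divr_gt0.
(* The form of [p] is within [e / C] of the supremum, so no refinement can raise it by more;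
   [refinement_le] then makes [p] a Cauchy centre for [e]. *)
have [_ [p [p0 /eqP pt] <-] hp] := sup_adherent eC hS.
exists (step_sum f 0 p), p; first by split=> //; rewrite pt.
move=> q [[q0 /eqP qt] pq] /=; rewrite sqBC.
apply: le_lt_trans (refinement_le fB fC (lexx 0) p0 q0 _ _ pq) _; rewrite ?pt ?qt//.
have : form_sum f 0 q <= sup S.
  by apply: ub_le_sup; [exact: hS.2|exists q => //; split=> //; rewrite qt].
by rewrite -ltr_pdivlMl// mulrC; lra.
Qed.

End StepSums.

(** * From step sums to Riemann-Stieltjes sums of martingales *)

Lemma RS_sumE (R : realType) (H : completeNormedModType (complex R))
    (f X : R -> H -> H) (Omega : H) (p : seq R) :
  RS_sum f X p Omega = step_sum (fun t => X t Omega) f 0 p.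
Proof.
rewrite /RS_sum; move: (0 : R) => s.
(* The default of [nth] and the starting point are both [0]; they are separated because the
   induction moves only the latter. *)
suff E : forall s0 s, (\sum_(k < size p) (f (nth s0 (s :: p) k) \o
    (X (nth s0 (s :: p) k.+1) - X (nth s0 (s :: p) k)))) Omega =
    step_sum (fun t => X t Omega) f s p by exact: E.
move=> s0; elim: p s => [|r p IH] s' t /=; first by rewrite big_ord0.
by rewrite big_ord_recl /= -IH.
Qed.

(** With [c = b' \o a] the product is the state at [c \o X t] minus that at [c \o X s]. These agree,
    since [E s] sends [c \o X t] to [c \o X s] by the module property and preserves the state. *)
Lemma martingale_orth (R : realType) (H : completeNormedModType (complex R))
    (dot : {dot H for Num.conj}) (A : set (H -> H)) (Omega : H)
    (At : R -> set (H -> H)) (E : R -> (H -> H) -> (H -> H)) (X : R -> H -> H) :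
  hilbert_norm dot -> von_neumann_algebra dot A ->
  filtration dot A Omega At E -> martingale A E X ->
  forall s t a w, 0 <= s -> s <= t -> At s a -> vector_orbit (At s) Omega w ->
    rdot dot (a (X t Omega - X s Omega)) w = 0.
Proof.
move=> hn hA hF [XA XE] s t a _ s0 st Aa [b Ab <-].
have t0 := le_trans s0 st; have hAs := filtration_vN hF s0.
have [b' Ab' bb'] : exists2 b', At s b' & is_adjoint dot b b'.
  by case: hAs => _ + _; exact.
pose c := b' \o a; have Ac : At s c by exact: vN_comp hAs _ _.
have cond := filtration_condexp hF s0.
have cX : A (c \o X t).
  by apply: (vN_comp hA); [exact: (filtration_sub hF s0)|exact: XA].
have Ec : E s (c \o X t) = c \o X s.
  by have := condexp_bimodule cond Ac (XA t t0) (vN_id hAs); rewrite XE.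
have := filtration_state hF s0 cX; rewrite Ec /vector_state => h.
have cb : bounded_operator c by exact: (vN_bounded hAs).
have -> : rdot dot (a (X t Omega - X s Omega)) (b Omega) =
          rdot dot (c (X t Omega - X s Omega)) Omega.
  by rewrite /rdot (is_adjoint_sym bb').
by rewrite bounded_opB// rdotBl {2}/rdot h subrr.
Qed.

Lemma martingale_adapted (R : realType) (H : completeNormedModType (complex R))
    (dot : {dot H for Num.conj}) (A : set (H -> H)) (Omega : H)
    (At : R -> set (H -> H)) (E : R -> (H -> H) -> (H -> H)) (X : R -> H -> H) :
  filtration dot A Omega At E -> martingale A E X -> adapted At X.
Proof.
move=> hF [XA XE] t t0; rewrite -(XE t t t0 (lexx t)).
exact: (condexp_range (filtration_condexp hF t0)) (XA t t0).
Qed.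

Lemma op_leN (R : realType) (H : completeNormedModType (complex R))
    (dot : {dot H for Num.conj}) (a b : H -> H) :
  op_le dot a b -> op_le dot (- b) (- a).
Proof. by rewrite /op_le opprK addrC. Qed.

(** Needed for the sums to commute with the commutant. *)
Lemma RS_sum_mem (R : realType) (H : completeNormedModType (complex R))
    (dot : {dot H for Num.conj}) (A : set (H -> H)) (f X : R -> H -> H)
    (t : R) (p : seq R) :
  von_neumann_algebra dot A -> process A f -> process A X ->
  itv_partition 0 t p -> A (RS_sum f X p).
Proof.
move=> hA fA XA [p0 _].
have ge0 k : (k <= size p)%N -> 0 <= nth 0 (0 :: p) k.
  move=> kp; have : nth 0 (0 :: p) k \in 0 :: p by rewrite mem_nth.
  rewrite inE => /orP[/eqP ->//|kin]; apply: ltW.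
  by have /allP := order_path_min lt_trans p0; exact.
apply: big_ind => [||k _].
- by rewrite -(subrr id); apply: (vN_sub hA); exact: vN_id hA.
- by move=> a b Aa Ab; rewrite -[a]scale1r; exact: vN_lin hA _ _.
- apply: (vN_comp hA); first by apply/fA/ge0/ltnW.
  by apply: (vN_sub hA); apply/XA/ge0 => //; exact: ltnW.
Qed.

Theorem theorem1 (R : realType) (H : completeNormedModType (complex R))
    (dot : {dot H for Num.conj}) (A : set (H -> H)) (Omega : H)
    (At : R -> set (H -> H)) (E : R -> (H -> H) -> (H -> H))
    (X f : R -> H -> H) :
  hilbert_norm dot ->
  von_neumann_algebra dot A ->
  `|Omega| = 1 -> cyclic A Omega -> separating A Omega ->
  filtration dot A Omega At E ->
  martingale A E X ->
  process A f -> adapted At f -> hermitian_process dot f ->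
  monotone_process dot f ->
  forall t : R, 0 < t ->
  [/\ forall x', commutant A x' ->
        cvg (RS_sum f X th (x' Omega) @[th --> refinement_filter t]),
      densely_defined_operator (vector_orbit (commutant A) Omega) (RS_integral f X t) &
      affiliated A (vector_orbit (commutant A) Omega) (RS_integral f X t)].
Proof.
move=> hn hA _ _ sep hF mX fA fAt fh fm t t0.
have Ab := vN_bounded hA.
have PF := refinement_filter_proper t0.
have Xad := martingale_adapted hF mX.
have cS g : (forall r, 0 <= r -> At r (g r)) ->
    (forall r, 0 <= r -> hermitian_op dot (g r)) ->
    (forall s r, 0 <= s -> s <= r -> op_le dot (g s) (g r)) ->
    cvg (step_sum (fun t => X t Omega) g 0 p @[p --> refinement_filter t]).
  apply: (step_sum_cvg (Omega := Omega) hn (filtration_vN hF) (filtration_incr hF)) t0.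
  - by move=> r r0; exists (X r) => //; exact: Xad.
  - exact: martingale_orth hF mX.
have cOmega : cvg (RS_sum f X p Omega @[p --> refinement_filter t]).
  under eq_fun do rewrite RS_sumE.
  case: fm => fm; first exact: cS.
  have : cvg (step_sum (fun t => X t Omega) (- f) 0 p @[p --> refinement_filter t]).
    apply: cS => [r r0|r r0 u v|s r s0 sr].
    - exact: vN_opp (filtration_vN hF r0) (fAt r r0).
    - by rewrite !fctE linearNl linearNr; congr (- _); exact: fh.
    - exact: op_leN (fm _ _ s0 sr).
  have -> : (fun p => step_sum (fun t => X t Omega) f 0 p) =
            - (fun p => step_sum (fun t => X t Omega) (- f) 0 p).
    by apply/funext => p; rewrite !fctE step_sumN opprK.
  exact: is_cvgN.
(* The integral will send [x' Omega] to [x' zeta]; linearity and affiliation both follow from this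
   formula. *)
pose zeta := lim (RS_sum f X p Omega @[p --> refinement_filter t]).
have cI x' : commutant A x' ->
    RS_sum f X p (x' Omega) @[p --> refinement_filter t] --> x' zeta.
  move=> cx'.
  have cx : x' (RS_sum f X p Omega) @[p --> refinement_filter t] --> x' zeta.
    exact: (continuous_cvg _ (cx'.1.2 zeta) cOmega).
  (* Commutation is available only on genuine partitions, where the times are nonnegative; the
     partitions refining [[:: t]] form a set of the filter. *)
  apply: cvg_trans cx; apply: near_eq_cvg.
  exists [:: t]; first exact: itv_partition1.
  move=> p [pt _]; apply/esym/(commutantE _ cx').
  exact: RS_sum_mem hA fA mX.1 pt.
have IE x' : commutant A x' -> RS_integral f X t (x' Omega) = x' zeta.
  by move=> cx'; apply: cvg_lim (cI _ cx'); exact: norm_hausdorff.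
have orb0 : vector_orbit (commutant A) Omega 0.
  exists (0 *: id); first by apply: commutantZ => //; exact: commutant_id.
  by rewrite !fctE scale0r.
split.
- by move=> x' cx'; apply/cvg_ex; exists (x' zeta); exact: cI.
- split=> //; first exact (separating_commutant_cyclic hn hA sep).
  move=> c _ _ [a ca <-] [b cb <-].
  have cab := commutant_lin c Ab ca cb.
  have E' u : c *: a u + b u = (c *: a + b) u by [].
  split; first by exists (c *: a + b).
  by rewrite [X in RS_integral _ _ _ X]E' !IE.
- move=> y' cy' _ [a ca <-]; have cya := commutant_comp cy' ca.
  split; first by exists (y' \o a).
  by rewrite -[y' (a Omega)]/((y' \o a) Omega) !IE.
Qed.
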